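(* Let $N\ge 5$, $G=2^{N-1}$, let $L<M<G$ be powers of $2$, and let $S$ be an integer with $1\le S<L$. Let $u,v$ be integers that are labels of the $2^N$-ion emanation tables with strut constants $S$, $S+L$ and $S+L+M$. If the cell with row label $u$ and column label $v$ is filled in the $2^N$-ion emanation table with strut constant $S$, and is not filled in the one with strut constant $S+L$, then it is filled in the one with strut constant $S+L+M$.
   Context: Write $\oplus$ for bitwise XOR of nonnegative integers. The $2^N$-ions: the real algebra with basis $i_0=1,i_1,\dots,i_{2^N-1}$, with $i_a^2=-1$ for $a\ne 0$, $i_ai_b=-i_bi_a=\pm i_{a\oplus b}$ for distinct nonzero $a,b$. Signs are fixed by cyclically positive triplets (trips): ''$(a,b,c)$ is a trip'' means $i_ai_b=i_c$, $i_bi_c=i_a$, $i_ci_a=i_b$. Start from the trip $(1,2,3)$ of the Quaternions ($N=2$). Passing from the $2^{k}$-ions to the $2^{k+1}$-ions ($k\ge 2$), with $H=2^{k}$: (Rule 0) all old trips are kept; (Rule 1) $(u,H,H+u)$ is a trip for $0<u<H$; (Rule 2) for every trip $(a,b,c)$ with all entries $<H$, the triples $(a,c+H,b+H)$, $(b,a+H,c+H)$, $(c,b+H,a+H)$ are trips. Emanation table (ET): for the $2^N$-ions let $G=2^{N-1}$ and let $T$ be a strut constant, $0<T<G$. The labels (L-indices) are the integers $u$ with $1\le u\le G-1$, $u\neq T$; rows and columns are both indexed by the labels. The Assessor of $u$ with respect to $T$ is the plane spanned by $i_u$ and $i_{U}$, where $U=G+(u\oplus T)$; its diagonals are the lines spanned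 by $i_u+i_U$ and $i_u-i_U$. The cell with row label $u$ and column label $v$ is filled exactly when some diagonal of the Assessor of $u$ times some diagonal of the Assessor of $v$ is zero (a DMZ). Filled cells correspond to edges of Box-Kites. Cells with $u=v$ or $u\oplus v=T$ are always blank. *)

(* Defs.v *)
From Stdlib Require Import PeanoNat.
From mathcomp Require Import all_boot all_order all_algebra.
From mathcomp Require Import reals.

Set Implicit Arguments.
Unset Strict Implicit.
Unset Printing Implicit Defensive.

Import GRing.Theory.
Local Open Scope ring_scope.

Definition xorn (a b : nat) : nat := Nat.lxor a b.

(* One step of trip generation, from the H-ions to the 2H-ions. The list s
   holds one representative of each trip up to cyclic rotation; the entries of
   the old trips are all < H, and rotating (a, b, c) only permutes the three
   trips that Rule 2 derives from it. *)
Definition next_trips (H : nat) (s : seq (nat * nat * nat)) :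
    seq (nat * nat * nat) :=
  s
  ++ [seq (u, H, (H + u)%N) | u <- iota 1 H.-1]
  ++ flatten [seq (let: (a, b, c) := t in
                   [:: (a, (c + H)%N, (b + H)%N);
                       (b, (a + H)%N, (c + H)%N);
                       (c, (b + H)%N, (a + H)%N)]) | t <- s].

Fixpoint trips_from2 (m : nat) : seq (nat * nat * nat) :=
  if m is m'.+1 then next_trips (2 ^ m'.+2)%N (trips_from2 m')
  else [:: (1%N, 2%N, 3%N)].

(* Only meaningful for N >= 2. *)
Definition trips (N : nat) : seq (nat * nat * nat) := trips_from2 (N - 2)%N.

Definition trip (N a b c : nat) : bool :=
  [|| (a, b, c) \in trips N, (b, c, a) \in trips N | (c, a, b) \in trips N].

Section Ions.

Variables (R : realType) (N : nat).

(* The basis element i_a, for a < 2 ^ N (zero otherwise). *)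
Definition ibasis (a : nat) : 'rV[R]_(2 ^ N) :=
  \row_(k < 2 ^ N) (k == a :> nat)%:R.

(* i_a i_b = isign a b *: i_(a xor b). For distinct nonzero a, b, exactly one of
   (a, b, a xor b) and (b, a, a xor b) is a trip; the latter gives
   i_a i_b = - i_b i_a = - i_(a xor b). *)
Definition isign (a b : nat) : R :=
  if (a == 0%N) || (b == 0%N) then 1
  else if a == b then -1
  else if trip N a b (xorn a b) then 1 else -1.

Definition imul (x y : 'rV[R]_(2 ^ N)) : 'rV[R]_(2 ^ N) :=
  \sum_(a < 2 ^ N) \sum_(b < 2 ^ N)
     (x 0 a * y 0 b * isign a b) *: ibasis (xorn a b).

Definition gen : nat := (2 ^ (N - 1))%N.

Definition is_label (T u : nat) : bool :=
  [&& (1 <= u)%N, (u <= gen - 1)%N & u != T].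

Definition strut_partner (T u : nat) : nat := (gen + xorn u T)%N.

Definition diagonals (T u : nat) : seq {vspace 'rV[R]_(2 ^ N)} :=
  [:: <[ibasis u + ibasis (strut_partner T u)]>%VS;
      <[ibasis u - ibasis (strut_partner T u)]>%VS].

Definition filled (T u v : nat) : Prop :=
  exists D E : {vspace 'rV[R]_(2 ^ N)},
    [/\ D \in diagonals T u, E \in diagonals T v
      & forall x y, x \in D -> y \in E -> imul x y = 0].

End Ions.

(* Main.v *)
From Stdlib Require Import PeanoNat.
Require Import Defs.
From mathcomp Require Import all_boot all_order all_algebra.
From mathcomp Require Import reals zify.

Set Implicit Arguments.
Unset Strict Implicit.
Unset Printing Implicit Defensive.

(** The product of two diagonals, from the Assessors of u and v, is a
    combination of two basis elements only, so it vanishes for a suitable choice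
    of diagonals exactly when the four products i_x i_y, with x in {u, U} and
    y in {v, V}, have signs of product +1.  The doubling rules turn this into a
    condition on the lower half of the algebra: with [quad T u v] the parity of
    the positive signs among the products i_x i_y, where x is in {u, u xor T}
    and y in {v, v xor T}, the cell (u, v) is filled iff [quad T u v] holds and
    u, v are independent modulo the subgroup {0, T} of the integers under xor
    ([filledP]).

    The parity [quad] is governed by the binary expansion of T.  Let H be a
    power of two, and let u', v' be the remainders of u, v modulo H.  Adding H
    to one or both factors of a generic product i_a i_b (a, b < H distinct and
    nonzero) reverses its sign.  Consequently, for independent u and v:
    - if T < H, the bits of u and v from H on change an even number of the four
      signs, and quad T u v = quad T u' v' as long as u', v' are still
      independent modulo {0, T} ([quad_mod]);
    - if T = t + H with 0 < t < H, three of the four signs are reversed, and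
      quad T u v is the negation of quad t u' v' as long as u', v' are
      independent modulo {0, t} ([quad_mod_flip]).
    When independence is lost by passing to remainders, the exceptional signs of
    products with H itself, or of i_a by i_(a + H), come into play, and they
    always make [quad] true.

    For the theorem, suppose that u and v are independent modulo {0, S + L}.  As
    the cell is not filled for S + L, [quad_mod_flip] leaves only one
    possibility: the remainders of u and v by L are independent modulo {0, S},
    with [quad] true.  Then [quad] is false for S + L and true again for
    S + L + M, one negation for each added bit.  If u and v are dependent modulo
    {0, S + L}, then u xor v = S + L, so that the remainders of u and v by M are
    dependent modulo {0, S + L} too, and the exceptional case makes the cell
    filled for S + L + M. *)

(** * Bitwise exclusive or and powers of two *)

Lemma xornC : commutative xorn. Proof. exact: Nat.lxor_comm. Qed.
Lemma xornA : associative xorn.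
Proof. by move=> a b c; rewrite /xorn Nat.lxor_assoc. Qed.
Lemma xor0n : left_id 0 xorn. Proof. exact: Nat.lxor_0_l. Qed.
Lemma xorn0 : right_id 0 xorn. Proof. exact: Nat.lxor_0_r. Qed.
Lemma xornn : self_inverse 0 xorn. Proof. exact: Nat.lxor_nilpotent. Qed.

Lemma xornK b : cancel (xorn^~ b) (xorn^~ b).
Proof. by move=> a; rewrite -xornA xornn xorn0. Qed.

Lemma xorKn a : cancel (xorn a) (xorn a).
Proof. by move=> b; rewrite xornA xornn xor0n. Qed.

Lemma xorn_eq0 a b : (xorn a b == 0) = (a == b).
Proof. by apply/eqP/eqP => [/Nat.lxor_eq|->]; rewrite ?xornn. Qed.

Lemma xorn_eq a b c : (xorn a b == c) = (a == xorn c b).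
Proof. by apply/eqP/eqP => [<-|->]; rewrite xornK. Qed.

Lemma pow2E k : Nat.pow 2 k = 2 ^ k.
Proof. by elim: k => // k IHk; rewrite expnS -IHk. Qed.

Lemma modn_pow2E a k : Nat.modulo a (Nat.pow 2 k) = a %% 2 ^ k.
Proof.
rewrite pow2E; symmetry; apply: (Nat.mod_unique _ _ (a %/ 2 ^ k)).
  by apply/ltP; rewrite ltn_mod expn_gt0.
by rewrite {1}(divn_eq a (2 ^ k)) mulnC.
Qed.

Lemma xorn_mod a b k : xorn a b %% 2 ^ k = xorn (a %% 2 ^ k) (b %% 2 ^ k).
Proof.
rewrite -!modn_pow2E; apply: Nat.bits_inj => i; rewrite Nat.lxor_spec.
case: (Nat.lt_ge_cases i k) => hi.
  by rewrite !Nat.mod_pow2_bits_low // Nat.lxor_spec.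
by rewrite !Nat.mod_pow2_bits_high.
Qed.

Lemma xorn_lt a b k : a < 2 ^ k -> b < 2 ^ k -> xorn a b < 2 ^ k.
Proof.
by move=> ha hb; rewrite -(modn_small ha) -(modn_small hb) -xorn_mod ltn_mod expn_gt0.
Qed.

(** Adding a power of two above all the bits of a is carry-free; this turns the
    sums by which the doubling rules are written into exclusive ors. *)
Lemma addn_pow2 a k : a < 2 ^ k -> a + 2 ^ k = xorn a (2 ^ k).
Proof.
move=> ha; rewrite -pow2E; apply: Nat.add_nocarry_lxor.
apply: Nat.bits_inj => i; rewrite Nat.land_spec Nat.bits_0 Nat.pow2_bits_eqb.
case: Nat.eqb_spec => [<-|_]; last by rewrite andbF.
by rewrite -(modn_small ha) -modn_pow2E Nat.mod_pow2_bits_high.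
Qed.

Section TopBit.
Variables (k a b : nat).
Hypotheses (ha : a < 2 ^ k) (hb : b < 2 ^ k).

Lemma xorn_addr : xorn a (b + 2 ^ k) = xorn a b + 2 ^ k.
Proof. by rewrite !addn_pow2 ?xornA ?xorn_lt. Qed.

Lemma xorn_addl : xorn (a + 2 ^ k) b = xorn a b + 2 ^ k.
Proof. by rewrite xornC !addn_pow2 ?xorn_lt // xornA (xornC b). Qed.

Lemma xorn_add2 : xorn (a + 2 ^ k) (b + 2 ^ k) = xorn a b.
Proof. by rewrite !addn_pow2 // xornA -(xornA a) (xornC _ b) xornA xornK. Qed.
End TopBit.

(** * Trips of the doubled algebra *)

Definition bounded (H : nat) (s : seq (nat * nat * nat)) : bool :=
  all (fun t => [&& 0 < t.1.1 < H, 0 < t.1.2 < H & 0 < t.2 < H]) s.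

Definition cyc (s : seq (nat * nat * nat)) (a b c : nat) : bool :=
  [|| (a, b, c) \in s, (b, c, a) \in s | (c, a, b) \in s].

Lemma tripE N a b c : trip N a b c = cyc (trips N) a b c.
Proof. by []. Qed.

Lemma cyc_rot s a b c : cyc s a b c = cyc s b c a.
Proof. by rewrite /cyc [RHS]orbA orbC. Qed.

Section NextTrips.
Variables (H : nat) (s : seq (nat * nat * nat)).
Hypothesis (sH : bounded H s).

Lemma bounded_mem a b c :
  (a, b, c) \in s -> [&& 0 < a < H, 0 < b < H & 0 < c < H].
Proof. by move=> /(allP sH). Qed.

Lemma next_trips_bounded : bounded H.*2 (next_trips H s).
Proof.
apply/allP => -[[x y] z]; rewrite /next_trips !mem_cat => /orP[/bounded_mem|/orP[]].
- by rewrite /=; lia.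
- by case/mapP => u; rewrite mem_iota => hu [-> -> ->] /=; lia.
case/flattenP => r /mapP[[[a b] c]] /bounded_mem habc ->.
by rewrite !inE !xpair_eqE /= => h; lia.
Qed.

Lemma mem_next_low x y z :
  (y < H) || (z < H) -> ((x, y, z) \in next_trips H s) = ((x, y, z) \in s).
Proof.
move=> hyz; rewrite /next_trips !mem_cat; case: (boolP (_ \in s)) => //= _.
apply/negP => /orP[].
  by case/mapP => u; rewrite mem_iota => hu [_ hy hz]; lia.
case/flattenP => r /mapP[[[a b] c]] /bounded_mem habc ->.
by rewrite !inE !xpair_eqE /= => h; lia.
Qed.

(** Each of the three triples that Rule 2 attaches to (a, b, c) comes from a
    different rotation, which is why membership upstairs amounts to being a trip
    downstairs up to rotation. *)
Lemma mem_next_high x y z :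
  x < H ->
  ((x, y + H, z + H) \in next_trips H s) =
    [&& 0 < x, y == 0 & z == x] || cyc s x z y.
Proof.
move=> hx; rewrite /next_trips !mem_cat.
have -> : ((x, y + H, z + H) \in s) = false.
  by apply/negP => /bounded_mem; lia.
rewrite /=; congr (_ || _).
  apply/mapP/idP => [[u]|/and3P[x_gt0 /eqP-> /eqP->]].
    by rewrite mem_iota => hu [-> hy hz]; lia.
  by exists x; rewrite ?mem_iota ?add0n 1?addnC //; lia.
apply/flattenP/idP => [[r /mapP[[[a b] c]] hs ->]|].
  rewrite !inE !xpair_eqE !eqn_add2r /cyc.
  by case/or3P => /andP[/andP[/eqP-> /eqP->] /eqP->]; rewrite hs ?orbT.
by case/or3P => hs; (eexists; first by apply/mapP; eexists; first exact: hs);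
   rewrite !inE eqxx ?orbT.
Qed.

Lemma cyc_next_low a b c :
  a < H -> b < H -> c < H -> cyc (next_trips H s) a b c = cyc s a b c.
Proof. by move=> ha hb hc; rewrite /cyc !mem_next_low ?ha ?hb ?hc. Qed.

Lemma cyc_next_high a b c :
  a < H ->
  cyc (next_trips H s) a (b + H) (c + H) =
    [&& 0 < a, b == 0 & c == a] || cyc s a c b.
Proof.
move=> ha; rewrite {1}/cyc mem_next_high // !mem_next_low ?ha ?orbT //.
have -> : ((b + H, c + H, a) \in s) = false by apply/negP => /bounded_mem; lia.
have -> : ((c + H, a, b + H) \in s) = false by apply/negP => /bounded_mem; lia.
by rewrite !orbF.
Qed.

Lemma cyc_gt0 a b c : cyc s a b c -> [&& 0 < a, 0 < b & 0 < c].
Proof. by case/or3P => /bounded_mem; lia. Qed.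

End NextTrips.

Lemma trips_succ N : 1 < N -> trips N.+1 = next_trips (2 ^ N) (trips N).
Proof. by case: N => [|[|N]] // _; rewrite /trips !subSS !subn0. Qed.

Lemma trips_bounded N : 1 < N -> bounded (2 ^ N) (trips N).
Proof.
elim: N => // -[|N] IHN // _; case: N IHN => // N /(_ isT) IHN.
by rewrite trips_succ // expnS mul2n; apply: next_trips_bounded.
Qed.

Lemma trip_rot N a b c : trip N a b c = trip N b c a.
Proof. exact: cyc_rot. Qed.

Lemma trip_stable N k a b c :
  1 < k <= N -> a < 2 ^ k -> b < 2 ^ k -> c < 2 ^ k ->
  trip N a b c = trip k a b c.
Proof.
move=> /andP[k_gt1 /subnK <-] ha hb hc.
elim: (N - k) => // n <-; rewrite addSn tripE trips_succ; last by lia.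
by apply: cyc_next_low;
  rewrite ?trips_bounded //; try lia; apply: (leq_trans (n := 2 ^ k)) => //;
  rewrite leq_exp2l //; lia.
Qed.

Lemma trip_top k a b c : 1 < k -> a < 2 ^ k ->
  trip k.+1 a (b + 2 ^ k) (c + 2 ^ k) =
    [&& 0 < a, b == 0 & c == a] || trip k a c b.
Proof.
by move=> k_gt1 ha; rewrite tripE trips_succ // cyc_next_high ?trips_bounded.
Qed.

Lemma trip_gt0 k a b c : 1 < k -> trip k a b c -> [&& 0 < a, 0 < b & 0 < c].
Proof. by move=> k_gt1; exact: (cyc_gt0 (trips_bounded k_gt1)). Qed.

Lemma top_bit k a : a < 2 ^ k.+1 ->
  exists b (e : bool), b < 2 ^ k /\ a = b + e * 2 ^ k.
Proof.
rewrite expnS => ha; case: (ltnP a (2 ^ k)) => h.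
  by exists a, false; rewrite mul0n addn0.
by exists (a - 2 ^ k), true; lia.
Qed.

(** This is the anticommutation of distinct imaginary units: i_a i_b and i_b i_a
    are opposite. *)
Lemma trip_anti k a b : 1 < k -> a < 2 ^ k -> b < 2 ^ k ->
  0 < a -> 0 < b -> a != b -> trip k a b (xorn a b) = ~~ trip k b a (xorn a b).
Proof.
elim: k a b => // k IHk.
case: (ltnP k 2) => [k_lt2 a b k_gt0|k_gt1 a b _].
  have -> : k = 1 by lia.
  by case: a b => [|[|[|[|a]]]] [|[|[|[|b]]]].
have low x y z : x < 2 ^ k -> y < 2 ^ k -> z < 2 ^ k ->
    trip k.+1 x y z = trip k x y z.
  by apply: trip_stable; rewrite k_gt1 leqnSn.
(* Up to rotation, three indices with exclusive or 0, not all below 2 ^ k,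
   consist of one below 2 ^ k followed by two above. *)
have high x y z : x < 2 ^ k -> y < 2 ^ k -> 0 < x -> z = xorn x y ->
    trip k.+1 x (y + 2 ^ k) (z + 2 ^ k) =
      ~~ trip k.+1 x (z + 2 ^ k) (y + 2 ^ k).
  move=> hx hy x_gt0 ->; have hz := xorn_lt hx hy.
  rewrite !trip_top // x_gt0 /=.
  have xFF y' : trip k x y' 0 = false.
    by apply/negP => /(trip_gt0 k_gt1); rewrite !andbF.
  have xF0 y' : trip k x 0 y' = false.
    by apply/negP => /(trip_gt0 k_gt1); rewrite andbF.
  case: (posnP y) => [->|y_gt0].
    by rewrite xorn0 eqxx /= [x == 0]gtn_eqF //= xF0.
  case: (eqVneq y x) => [->|yx].
    by rewrite xornn /= xF0.
  rewrite andbF /= [in RHS]IHk 1?eq_sym //.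
  by rewrite negbK [RHS]trip_rot.
case/top_bit=> {}a [[] [ha ->]] /top_bit[{}b [[] [hb ->]]];
  rewrite ?mul1n ?mul0n ?addn0.
- rewrite xorn_add2 // eqn_add2r => _ _ ab.
  rewrite 2!trip_rot [in RHS]trip_rot [in RHS]trip_rot.
  apply: high; rewrite ?xorn_lt // ?lt0n ?xorn_eq0 //.
  by rewrite xornC xorKn.
- rewrite xorn_addl // => _ b_gt0 ab.
  by rewrite trip_rot (high b a) ?negbK 1?xornC // trip_rot.
- rewrite xorn_addr // => a_gt0 _ ab; rewrite (high a b) //.
  by rewrite [in RHS]trip_rot.
by move=> a_gt0 b_gt0 ab; rewrite !low ?xorn_lt ?IHk.
Qed.

(** * Signs of the products of basis elements *)

Definition sgn (N a b : nat) : bool := trip N a b (xorn a b).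

Section Sign.
Variable N : nat.
Hypothesis N_gt1 : 1 < N.

Section Line.
Variables a b : nat.
Hypotheses (a_lt : a < 2 ^ N) (b_lt : b < 2 ^ N).
Hypotheses (a_gt0 : 0 < a) (b_gt0 : 0 < b) (ab : a != b).

Lemma sgn_anti : sgn N a b = ~~ sgn N b a.
Proof. by rewrite /sgn trip_anti // (xornC b). Qed.

Lemma sgn_line : sgn N a (xorn a b) = ~~ sgn N a b.
Proof.
by rewrite sgn_anti negbK /sgn xorKn -trip_rot xornC.
Qed.
End Line.

Section SignTop.
Variable k : nat.
Hypothesis k_lt : k < N.

Lemma pow2_lt x : x < 2 ^ k -> x < 2 ^ N.
Proof. by move/leq_trans; apply; rewrite leq_exp2l // ltnW. Qed.

Lemma add_pow2_lt x : x < 2 ^ k -> x + 2 ^ k < 2 ^ N.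
Proof.
move=> hx; apply: (@leq_trans (2 ^ k.+1)); last by rewrite leq_exp2l.
by rewrite expnS mul2n -addnn ltn_add2r.
Qed.

(** This is Rule 1; only the smallest algebra escapes it, as its unique trip is
    given. *)
Lemma sgn_pow2r a : a < 2 ^ k -> 0 < a -> sgn N a (2 ^ k).
Proof.
move=> ha a_gt0; rewrite /sgn -addn_pow2 //.
case: (ltnP 1 k) => [k_gt1|k_le1].
  rewrite (@trip_stable _ k.+1) ?expnS; try lia.
  by rewrite -[X in trip _ _ X]add0n trip_top // a_gt0 !eqxx.
case: k k_le1 ha => [|[|]] //= _; case: a a_gt0 => [|[|]] // _ _.
by rewrite (@trip_stable _ 2).
Qed.

(** The next lemmas all say that raising one or both factors above 2 ^ k reverses
    the sign of a generic product.  The sections are separate so that each lemma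
    can be instantiated at other pairs in the following one. *)
Section GenericRight.
Variables a b : nat.
Hypotheses (ha : a < 2 ^ k) (hb : b < 2 ^ k).
Hypotheses (a_gt0 : 0 < a) (b_gt0 : 0 < b) (ab : a != b).

(** This is Rule 2: in (a, c + H, b + H) the cyclic order of b and c is the
    opposite of that in (a, b, c). *)
Lemma sgn_topr : sgn N a (b + 2 ^ k) = ~~ sgn N a b.
Proof.
case: (ltnP 1 k) => [k_gt1|k_le1]; last first.
  by case: k k_le1 ha hb => [|[|]] //=; lia.
have hc := xorn_lt ha hb.
rewrite -sgn_line ?pow2_lt // /sgn xorKn xorn_addr //.
rewrite (@trip_stable N k.+1) ?expnS; try lia.
rewrite trip_top // [b == 0]gtn_eqF //= andbF /=.
by apply/esym/trip_stable => //; rewrite k_gt1 ltnW.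
Qed.
End GenericRight.

Section GenericLeft.
Variables a b : nat.
Hypotheses (ha : a < 2 ^ k) (hb : b < 2 ^ k).
Hypotheses (a_gt0 : 0 < a) (b_gt0 : 0 < b) (ab : a != b).

Lemma sgn_topl : sgn N (a + 2 ^ k) b = ~~ sgn N a b.
Proof.
rewrite sgn_anti ?add_pow2_lt ?pow2_lt //; try lia.
by rewrite sgn_topr 1?eq_sym // negbK (@sgn_anti a) ?pow2_lt // negbK.
Qed.
End GenericLeft.

Section GenericBoth.
Variables a b : nat.
Hypotheses (ha : a < 2 ^ k) (hb : b < 2 ^ k).
Hypotheses (a_gt0 : 0 < a) (b_gt0 : 0 < b) (ab : a != b).

Lemma sgn_top2 : sgn N (a + 2 ^ k) (b + 2 ^ k) = ~~ sgn N a b.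
Proof.
rewrite -[b + _](xorKn (a + 2 ^ k)) xorn_add2 //.
have ab_gt0 : 0 < xorn a b by rewrite lt0n xorn_eq0.
have ab_a : a != xorn a b by rewrite eq_sym xornC xorn_eq xornn -lt0n.
rewrite sgn_line ?add_pow2_lt ?pow2_lt ?xorn_lt //; try lia.
  by rewrite sgn_topl ?xorn_lt // sgn_line ?pow2_lt // negbK.
by move: (xorn_lt ha hb); lia.
Qed.

Lemma sgn_top (e f : bool) :
  sgn N (a + e * 2 ^ k) (b + f * 2 ^ k) = (e || f) (+) sgn N a b.
Proof.
case: e; case: f; rewrite ?mul1n ?mul0n ?addn0;
  [exact: sgn_top2|exact: sgn_topl|exact: sgn_topr|by []].
Qed.
End GenericBoth.

(** Products with 2 ^ k itself, and products of a with a + 2 ^ k, do not follow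
    the generic rule. *)
Section Special.
Variable a : nat.
Hypotheses (ha : a < 2 ^ k) (a_gt0 : 0 < a).

Let H_lt : 2 ^ k < 2 ^ N. Proof. by rewrite ltn_exp2l. Qed.
Let H_gt0 : 0 < 2 ^ k. Proof. by rewrite expn_gt0. Qed.
Let aH : a != 2 ^ k. Proof. by rewrite ltn_eqF. Qed.

Lemma sgn_pow2l : sgn N (2 ^ k) a = false.
Proof. by rewrite sgn_anti ?H_lt ?pow2_lt ?sgn_pow2r // eq_sym. Qed.

Lemma sgn_self : sgn N a (a + 2 ^ k) = false.
Proof. by rewrite addn_pow2 // sgn_line ?H_lt ?pow2_lt ?sgn_pow2r. Qed.

Lemma sgn_selfl : sgn N (a + 2 ^ k) a = true.
Proof. by rewrite sgn_anti ?add_pow2_lt ?pow2_lt ?sgn_self //; lia. Qed.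

Lemma sgn_pow2_top (e : bool) : sgn N (2 ^ k) (a + e * 2 ^ k) = e.
Proof.
case: e; rewrite ?mul1n ?addn0 ?sgn_pow2l //.
by rewrite addn_pow2 // xornC sgn_line ?H_lt ?pow2_lt ?sgn_pow2l // eq_sym.
Qed.
End Special.
End SignTop.

(** * The parity of the four signs *)

(** The parity of the number of positive signs among the products of an element
    of the coset {u, u xor T} by an element of the coset {v, v xor T}. *)
Definition quad (T u v : nat) : bool :=
  sgn N u v (+) sgn N (xorn u T) v (+)
  (sgn N u (xorn v T) (+) sgn N (xorn u T) (xorn v T)).

(** {0, T} is the line spanned by T in the vector space of natural numbers over
    the field with two elements. *)
Definition in_span (T x : nat) : bool := (x == 0) || (x == T).

(** For T nonzero, this is the linear independence of T, u and v over the field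
    with two elements, so that all the products occurring in [quad] are generic. *)
Definition indep (T u v : nat) : bool :=
  [&& ~~ in_span T u, ~~ in_span T v & ~~ in_span T (xorn u v)].

Lemma in_span_xor T x : in_span T (xorn x T) = in_span T x.
Proof. by rewrite /in_span xorn_eq0 xorn_eq xornn orbC. Qed.

Lemma in_span_add T x y : in_span T x -> in_span T (xorn x y) = in_span T y.
Proof. by case/orP=> /eqP ->; rewrite ?xor0n // xornC in_span_xor. Qed.

Lemma indep_xorl T u v : indep T (xorn u T) v = indep T u v.
Proof. by rewrite /indep -xornA (xornC T) xornA !in_span_xor. Qed.

Lemma indepC T u v : indep T u v = indep T v u.
Proof. by rewrite /indep xornC; case: in_span; case: in_span. Qed.

Lemma indep_mod T u v k :
  indep (T %% 2 ^ k) (u %% 2 ^ k) (v %% 2 ^ k) -> indep T u v.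
Proof.
have span x : in_span T x -> in_span (T %% 2 ^ k) (x %% 2 ^ k).
  by rewrite /in_span => /orP[] /eqP ->; rewrite ?mod0n eqxx ?orbT.
rewrite /indep -xorn_mod => /and3P[hu hv huv].
by rewrite (contra (span u)) ?(contra (span v)) ?(contra (span _)).
Qed.

Lemma quad_xorl T u v : quad T (xorn u T) v = quad T u v.
Proof. by rewrite /quad xornK (addbC (sgn _ u v)) (addbC (sgn _ u (xorn v T))). Qed.

Lemma indep_pair T u v : indep T u v -> [&& 0 < u, 0 < v & u != v].
Proof.
rewrite /indep /in_span xorn_eq0 !negb_or !lt0n.
by case/and3P => /andP[-> _] /andP[-> _] /andP[-> _].
Qed.

Lemma indep_square T u v : indep T u v ->
  [/\ [&& 0 < u, 0 < v & u != v], [&& 0 < xorn u T, 0 < v & xorn u T != v],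
      [&& 0 < u, 0 < xorn v T & u != xorn v T] &
      [&& 0 < xorn u T, 0 < xorn v T & xorn u T != xorn v T]].
Proof.
move=> huv; split; apply: (@indep_pair T); rewrite ?indep_xorl //;
  by rewrite indepC !indep_xorl indepC ?indep_xorl.
Qed.

Section Quad.
Variable T : nat.
Hypothesis T_lt : T < 2 ^ N.

Lemma quadC u v : u < 2 ^ N -> v < 2 ^ N -> indep T u v ->
  quad T u v = quad T v u.
Proof.
move=> hu hv /indep_square[/and3P[u0 v0 uv] /and3P[u'0 _ u'v]].
case/and3P=> _ v'0 uv' /and3P[_ _ u'v'].
have hu' := xorn_lt hu T_lt; have hv' := xorn_lt hv T_lt.
rewrite /quad (sgn_anti hu hv) // (sgn_anti hu' hv) // (sgn_anti hu hv') //.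
rewrite (sgn_anti hu' hv') //.
by case: sgn; case: sgn; case: sgn; case: sgn.
Qed.

Lemma quad_xorr u v : quad T u (xorn v T) = quad T u v.
Proof.
by rewrite /quad xornK [LHS]addbC.
Qed.

End Quad.

Section QuadLow.
Variables (k T : nat).
Hypotheses (k_lt : k < N) (T_lt : T < 2 ^ k) (T_gt0 : 0 < T).

Let lt_lift x (e : bool) : x < 2 ^ k -> x + e * 2 ^ k < 2 ^ N.
Proof.
by case: e => hx; rewrite ?mul1n ?mul0n ?addn0; [exact: add_pow2_lt|exact: pow2_lt hx].
Qed.

Lemma in_span_lift x (e : bool) :
  in_span T (x + e * 2 ^ k) = ~~ e && in_span T x.
Proof.
rewrite /in_span; case: e; rewrite ?mul1n ?mul0n ?addn0 //=.
by apply/negbTE; lia.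
Qed.

Lemma xorn_lift x y (e f : bool) : x < 2 ^ k -> y < 2 ^ k ->
  xorn (x + e * 2 ^ k) (y + f * 2 ^ k) = xorn x y + (e (+) f) * 2 ^ k.
Proof.
move=> hx hy; case: e; case: f; rewrite ?mul1n ?mul0n ?addn0;
by rewrite ?xorn_add2 ?xorn_addl ?xorn_addr.
Qed.

Lemma xorn_liftT x (e : bool) : x < 2 ^ k ->
  xorn (x + e * 2 ^ k) T = xorn x T + e * 2 ^ k.
Proof.
by move=> hx; have := xorn_lift e false hx T_lt; rewrite addn0 addbF.
Qed.

Lemma sgn_lineT x : x < 2 ^ k -> ~~ in_span T x ->
  sgn N T (xorn x T) = ~~ sgn N T x.
Proof.
rewrite /in_span negb_or -lt0n => hx /andP[x_gt0 xT].
by rewrite xornC sgn_line ?(pow2_lt k_lt) // eq_sym.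
Qed.

(** The products of 2 ^ k by the elements of one coset have equal signs, those of
    T by b and by b xor T have opposite ones, and so the parity is odd. *)
Lemma quad_pow2 b (f : bool) : b < 2 ^ k -> ~~ in_span T b ->
  quad T (2 ^ k) (b + f * 2 ^ k).
Proof.
move=> hb b_ind; have := b_ind; rewrite /in_span negb_or -lt0n.
case/andP=> b_gt0 bT; have hbT := xorn_lt hb T_lt.
have bT_gt0 : 0 < xorn b T by rewrite lt0n xorn_eq0.
have HT : xorn (2 ^ k) T = T + true * 2 ^ k by rewrite mul1n addn_pow2 // xornC.
rewrite /quad HT xorn_liftT //.
have TbT : T != xorn b T by rewrite eq_sym xorn_eq xornn -lt0n.
rewrite !sgn_pow2_top // !sgn_top // 1?eq_sym // sgn_lineT //.
by case: f; case: sgn.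
Qed.

(** The two products of the form x (x + 2 ^ k) have equal signs, and the two
    others reduce, by the generic rule, to products of a and a xor T in both
    orders, which have opposite signs. *)
Lemma quad_self a : a < 2 ^ k -> ~~ in_span T a -> quad T a (a + 2 ^ k).
Proof.
move=> ha; rewrite /in_span negb_or -lt0n.
case/andP=> a_gt0 aT; have haT := xorn_lt ha T_lt.
have aT_gt0 : 0 < xorn a T by rewrite lt0n xorn_eq0.
have aTa : xorn a T != a by rewrite xornC xorn_eq xornn -lt0n.
rewrite /quad xorn_addl // !sgn_self // !sgn_topr // 1?eq_sym //.
by rewrite sgn_anti ?(pow2_lt k_lt) //; case: sgn.
Qed.

(** If a and b are independent modulo {0, T}, the same sign change, or none,
    affects all four products.  Otherwise one of the indices, or their exclusive
    or, is 2 ^ k up to T, which is the situation of [quad_pow2] or of [quad_self]. *)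
Lemma quad_lift a b (e f : bool) : a < 2 ^ k -> b < 2 ^ k ->
  indep T (a + e * 2 ^ k) (b + f * 2 ^ k) ->
  quad T (a + e * 2 ^ k) (b + f * 2 ^ k) = (indep T a b ==> quad T a b).
Proof.
move=> ha hb ind; have haT := xorn_lt ha T_lt; have hbT := xorn_lt hb T_lt.
have [/indep_square[]|] /= := boolP (indep T a b).
  move=> /and3P[a0 b0 ab] /and3P[a'0 _ a'b] /and3P[_ b'0 ab'] /and3P[_ _ a'b'].
  rewrite /quad !xorn_liftT // !sgn_top //.
  by case: e {ind}; case: f; case: sgn; case: sgn; case: sgn; case: sgn.
have pow2 x y (h : bool) : x < 2 ^ k -> y < 2 ^ k -> in_span T x ->
    ~~ in_span T y -> quad T (x + 2 ^ k) (y + h * 2 ^ k).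
  move=> hx hy /orP[] /eqP-> y_ind; first by rewrite add0n quad_pow2.
  by rewrite addn_pow2 // xornC quad_xorl quad_pow2.
have self x y : x < 2 ^ k -> y < 2 ^ k -> in_span T (xorn x y) ->
    ~~ in_span T x -> quad T x (y + 2 ^ k).
  move=> hx hy /orP[]; first by rewrite xorn_eq0 => /eqP <-; exact: quad_self.
  rewrite xornC xorn_eq xornC => /eqP -> x_ind.
  by rewrite -quad_xorl quad_self ?xorn_lt ?in_span_xor.
have qC := quadC (pow2_lt k_lt T_lt) (lt_lift e ha) (lt_lift f hb) ind.
move: ind qC; rewrite /indep xorn_lift // !in_span_lift.
case: (boolP (in_span T a)) => [a_in|a_ind].
  case: e => //= ind _ _; rewrite mul1n pow2 //.
  by move: ind; rewrite in_span_add //; case: f; rewrite ?andbT.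
case: (boolP (in_span T b)) => [b_in|b_ind].
  by case: f; rewrite ?andbF //= => _ -> _; rewrite mul1n pow2.
rewrite /= negbK !andbF /= => ind qC ab_in.
move: ind qC; rewrite ab_in; case: e; case: f => //= _; rewrite !addn0 !mul1n.
  by move=> ->; rewrite self // xornC.
by move=> _; rewrite self.
Qed.

End QuadLow.

Section QuadHigh.
Variables (k t : nat).
Hypotheses (k_lt : k < N) (t_lt : t < 2 ^ k) (t_gt0 : 0 < t).
Let T := t + 2 ^ k.

Let xorT x : x < 2 ^ k -> xorn x T = xorn x t + 2 ^ k.
Proof. by move=> hx; rewrite /T xorn_addr. Qed.

(** Among the four products only i_a i_b has both factors below 2 ^ k: the
    generic rule reverses the three others, whence the negation.  If a and b are
    dependent modulo {0, t}, then a = t, b = t or b = a xor t, and some of the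
    products are exceptional. *)
Lemma quad_flip a b : a < 2 ^ k -> b < 2 ^ k -> indep T a b ->
  quad T a b = (indep t a b ==> ~~ quad t a b).
Proof.
move=> ha hb ind; have hat := xorn_lt ha t_lt; have hbt := xorn_lt hb t_lt.
have /and3P[a0 b0 ab] := indep_pair ind.
have [/indep_square[_]|] /= := boolP (indep t a b).
  move=> /and3P[a'0 _ a'b] /and3P[_ b'0 ab'] /and3P[_ _ a'b'].
  rewrite /quad !xorT // sgn_topl // sgn_topr // sgn_top2 //.
  by case: sgn; case: sgn; case: sgn; case: sgn.
have pt y : y < 2 ^ k -> 0 < y -> t != y -> quad T t y.
  move=> hy y_gt0 ty; have hyt := xorn_lt hy t_lt.
  have ty0 : 0 < xorn y t by rewrite lt0n xorn_eq0 eq_sym.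
  have tyt : t != xorn y t by rewrite eq_sym xorn_eq xornn -lt0n.
  rewrite /quad !xorT // xornn add0n sgn_pow2l //.
  have := sgn_pow2_top k_lt hyt ty0 true; rewrite mul1n => ->.
  rewrite sgn_topr //.
  rewrite xornC sgn_line ?(pow2_lt k_lt) //.
  by case: sgn.
have aT : a != T by rewrite ltn_eqF // /T; lia.
have bT : b != T by rewrite ltn_eqF // /T; lia.
rewrite /indep /in_span !negb_and !negbK !(gtn_eqF a0, gtn_eqF b0).
rewrite xorn_eq0 (negbTE ab) /=.
case/or3P => [/eqP at_|/eqP bt|abt].
- by rewrite at_ pt // -at_.
- have T_lt : T < 2 ^ N by exact: add_pow2_lt.
  by rewrite quadC ?T_lt ?(pow2_lt k_lt) // bt pt // -bt eq_sym.
have -> : b = xorn a t by move: abt; rewrite xornC xorn_eq xornC => /eqP.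
have at0 : 0 < xorn a t.
  by move: abt; rewrite xornC xorn_eq xornC => /eqP <-.
have ata : xorn a t != a by rewrite xornC xorn_eq xornn -lt0n.
rewrite /quad !xorT // xornK // sgn_selfl // sgn_self //.
rewrite sgn_top2 // sgn_anti ?(pow2_lt k_lt) //; first by case: sgn.
by rewrite eq_sym.
Qed.

(** Translation by T changes the bit 2 ^ k, and [quad] only depends on the cosets
    modulo {0, T}: representatives below 2 ^ k can be chosen. *)
Lemma quad_lift_flip a b (e f : bool) : a < 2 ^ k -> b < 2 ^ k ->
  indep T (a + e * 2 ^ k) (b + f * 2 ^ k) ->
  quad T (a + e * 2 ^ k) (b + f * 2 ^ k) = (indep t a b ==> ~~ quad t a b).
Proof.
move=> ha hb.
have flip x : x < 2 ^ k -> x + true * 2 ^ k = xorn (xorn x t) T.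
  by move=> hx; rewrite xorT ?xorn_lt // xornK mul1n.
have xt x : x < 2 ^ k -> xorn x t < 2 ^ k by move=> hx; rewrite xorn_lt.
have indr T' x y : indep T' x (xorn y T') = indep T' x y.
  by rewrite indepC indep_xorl indepC.
case: e; case: f; rewrite ?flip ?mul0n ?addn0 // ?indep_xorl ?indr ?quad_xorl ?quad_xorr.
all: by move=> ind; rewrite quad_flip ?xt // ?indep_xorl ?indr ?quad_xorl ?quad_xorr.
Qed.
End QuadHigh.

(** The upper bits are removed one at a time, by [quad_lift].  Once independence
    is lost it is not recovered modulo a smaller power of two, which makes the
    value true permanent. *)
Lemma quad_mod k T u v : k <= N -> T < 2 ^ k -> 0 < T ->
  u < 2 ^ N -> v < 2 ^ N -> indep T u v ->
  quad T u v = (indep T (u %% 2 ^ k) (v %% 2 ^ k)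
                ==> quad T (u %% 2 ^ k) (v %% 2 ^ k)).
Proof.
move=> k_le T_lt T_gt0; rewrite -(subnKC k_le).
have : k + (N - k) <= N by rewrite subnKC.
elim: (N - k) u v => [|n IHn] u v.
  by rewrite addn0 => _ hu hv ind; rewrite !modn_small // ind.
rewrite addnS => kn_lt /top_bit[a [e [ha ->]]] /top_bit[b [f [hb ->]]] ind.
have mod_top x (g : bool) : (x + g * 2 ^ (k + n)) %% 2 ^ k = x %% 2 ^ k.
  by rewrite expnD mulnCA [2 ^ k * _]mulnC addnC modnMDl.
have T_lt' : T < 2 ^ (k + n) by rewrite (leq_trans T_lt) // leq_exp2l ?leq_addr.
rewrite !mod_top quad_lift //.
have [ab_ind|ab_dep] /= := boolP (indep T a b).
  by apply: IHn; rewrite ?(pow2_lt kn_lt) // ltnW.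
case: (boolP (indep T _ _)) => // ind'; case/negP: ab_dep.
by apply: (@indep_mod _ _ _ k); rewrite (modn_small T_lt).
Qed.

Lemma quad_mod_flip k t u v : k < N -> t < 2 ^ k -> 0 < t ->
  u < 2 ^ N -> v < 2 ^ N -> indep (t + 2 ^ k) u v ->
  quad (t + 2 ^ k) u v = (indep t (u %% 2 ^ k) (v %% 2 ^ k)
                          ==> ~~ quad t (u %% 2 ^ k) (v %% 2 ^ k)).
Proof.
move=> k_lt t_lt t_gt0 hu hv ind.
have T_lt : t + 2 ^ k < 2 ^ k.+1 by rewrite expnS; lia.
rewrite (@quad_mod k.+1) //; last by lia.
have mod_mod x : x %% 2 ^ k.+1 %% 2 ^ k = x %% 2 ^ k.
  by rewrite modn_dvdm // dvdn_exp2l.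
case: (boolP (indep _ _ _)) => [|nind] /=.
  have [a [e [ha Ea]]] := @top_bit k (u %% 2 ^ k.+1) (ltn_pmod _ (expn_gt0 2 _)).
  have [b [f [hb Eb]]] := @top_bit k (v %% 2 ^ k.+1) (ltn_pmod _ (expn_gt0 2 _)).
  rewrite Ea Eb => ind'; rewrite quad_lift_flip //.
  have -> : a = u %% 2 ^ k by rewrite -mod_mod Ea addnC modnMDl modn_small.
  by have -> : b = v %% 2 ^ k by rewrite -mod_mod Eb addnC modnMDl modn_small.
case: (boolP (indep t _ _)) => // ind'; case/negP: nind.
by apply: (@indep_mod _ _ _ k); rewrite !mod_mod modnDr modn_small.
Qed.

End Sign.

(** * Products of diagonals *)

Section ZeroDivisors.
Import GRing.Theory Num.Theory.
Local Open Scope ring_scope.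
Variables (R : realType) (N : nat).
Local Notation e := (ibasis R N).

Lemma imulDl x x' y : imul (x + x') y = imul x y + imul x' y :> 'rV[R]_(2 ^ N).
Proof.
rewrite /imul -big_split; apply: eq_bigr => a _ /=.
rewrite -big_split; apply: eq_bigr => b _ /=.
by rewrite -scalerDl mxE !mulrDl.
Qed.

Lemma imulZl c x y : imul (c *: x) y = c *: imul x y :> 'rV[R]_(2 ^ N).
Proof.
rewrite /imul scaler_sumr; apply: eq_bigr => a _.
rewrite scaler_sumr; apply: eq_bigr => b _.
by rewrite scalerA mxE !mulrA.
Qed.

Lemma imulDr x y y' : imul x (y + y') = imul x y + imul x y' :> 'rV[R]_(2 ^ N).
Proof.
rewrite /imul -big_split; apply: eq_bigr => a _ /=.
rewrite -big_split; apply: eq_bigr => b _ /=.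
by rewrite -scalerDl mxE mulrDr mulrDl.
Qed.

Lemma imulZr c x y : imul x (c *: y) = c *: imul x y :> 'rV[R]_(2 ^ N).
Proof.
rewrite /imul scaler_sumr; apply: eq_bigr => a _.
rewrite scaler_sumr; apply: eq_bigr => b _.
by rewrite scalerA mxE !mulrA [x _ _ * c]mulrC.
Qed.

Lemma imul_ibasis a b : (a < 2 ^ N)%N -> (b < 2 ^ N)%N ->
  imul (e a) (e b) = isign R N a b *: e (xorn a b).
Proof.
move=> ha hb; rewrite /imul (bigD1 (Ordinal ha)) //= (bigD1 (Ordinal hb)) //=.
rewrite !mxE !eqxx !mul1r !big1 ?addr0 //.
  move=> i; rewrite -val_eqE => /negbTE /= hi.
  by rewrite big1 // => j _; rewrite !mxE hi !mul0r scale0r.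
by move=> j; rewrite -val_eqE => /negbTE /= hj; rewrite !mxE hj mulr0 mul0r scale0r.
Qed.

(** The exponent of -1 in the sign of i_a i_b, including the squares and the
    products with the unit 1. *)
Definition negative (a b : nat) : bool :=
  [&& a != 0, b != 0 & (a == b) || ~~ sgn N a b].

Lemma isignE a b : isign R N a b = (-1) ^+ negative a b.
Proof.
by rewrite /isign /negative /sgn; do 2!case: eqP => //=; case: eqP => //=; case: trip.
Qed.

Lemma addr_sign_eq0 (b c : bool) :
  ((-1) ^+ b + (-1) ^+ c == 0 :> R) = b (+) c.
Proof.
have two : (1 + 1 == 0 :> R) = false by rewrite (pnatr_eq0 _ 2).
by case: b; case: c; rewrite /= ?expr0 ?expr1 ?addNr ?addrN ?eqxx // -?opprD ?oppr_eq0.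
Qed.

Lemma ibasis_comb_eq0 (x y : R) a b :
  (a < 2 ^ N)%N -> (b < 2 ^ N)%N -> a != b ->
  (x *: e a + y *: e b == 0) = (x == 0) && (y == 0).
Proof.
move=> ha hb ab; apply/eqP/andP => [h|[/eqP-> /eqP->]]; last by rewrite !scale0r addr0.
move/rowP: h => h; have := h (Ordinal ha); have := h (Ordinal hb).
rewrite !mxE /= !eqxx (negbTE ab) eq_sym (negbTE ab).
by rewrite !mulr0 !mulr1 addr0 add0r => -> ->.
Qed.

Definition diagonal T u (s : bool) := e u + (-1) ^+ s *: e (strut_partner N T u).

Lemma filled_diagonal T u v :
  filled R N T u v <->
  exists s t : bool, imul (diagonal T u s) (diagonal T v t) = 0.
Proof.
have diagE w : diagonals R N T w = [seq <[diagonal T w s]>%VS | s <- [:: false; true]].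
  by rewrite /diagonals /diagonal /= expr0 expr1 scale1r scaleN1r.
split=> [[D [E []]]|[s [t st0]]].
  rewrite !diagE => /mapP[s _ ->] /mapP[t _ ->] h.
  by exists s, t; apply: h; apply: memv_line.
exists <[diagonal T u s]>%VS, <[diagonal T v t]>%VS; rewrite !diagE; split.
- by case: s {st0} => /=; rewrite !inE eqxx ?orbT.
- by case: t {st0} => /=; rewrite !inE eqxx ?orbT.
by move=> _ _ /vlineP[p ->] /vlineP[q ->]; rewrite imulZl imulZr st0 !scaler0.
Qed.

(** Two diagonals with signs s and t multiply to 0 iff s and t satisfy two
    equations, one for each basis element in the product.  Both only involve
    s xor t, and they are compatible iff the four signs have product +1. *)
Lemma filled_parity T u v : (u < gen N)%N -> (v < gen N)%N -> (T < gen N)%N ->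
  (0 < N)%N ->
  let U := strut_partner N T u in let V := strut_partner N T v in
  filled R N T u v <->
  ~~ (negative u v (+) negative U V (+) (negative u V (+) negative U v)).
Proof.
rewrite /gen /strut_partner => hu hv hT N_gt0 /=.
have NE : (2 ^ N = 2 ^ (N - 1) + 2 ^ (N - 1))%N.
  by rewrite addnn -mul2n -expnS subn1 prednK.
have huT := xorn_lt hu hT; have hvT := xorn_lt hv hT.
have huv := xorn_lt hu hv; have huvT := xorn_lt hu hvT.
rewrite filled_diagonal /diagonal /strut_partner /gen ![(2 ^ _ + xorn _ _)%N]addnC.
set U := (xorn u T + _)%N; set V := (xorn v T + _)%N.
have hU : (U < 2 ^ N)%N by rewrite /U; lia.
have hV : (V < 2 ^ N)%N by rewrite /V; lia.
have E (s t : bool) :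
  (imul (e u + (-1) ^+ s *: e U) (e v + (-1) ^+ t *: e V) == 0) =
  (negative u v (+) (s (+) t (+) negative U V)) &&
  ((t (+) negative u V) (+) (s (+) negative U v)).
  rewrite !(imulDl, imulDr, imulZl, imulZr) !imul_ibasis //; try lia.
  rewrite [xorn U V]xorn_add2 // [xorn U v]xorn_addl // [xorn u V]xorn_addr //.
  rewrite -!xornA (xornC T v) (xornC T (xorn v T)).
  rewrite -xornA xornn xorn0 !scalerA !isignE.
  rewrite [X in _ + X]addrC addrACA -!scalerDl -!signr_addb.
  by rewrite ibasis_comb_eq0 ?addr_sign_eq0 ?addbA //; lia.
split=> [[s [t /eqP]]|h].
  by rewrite E; do 4![case: negative]; case: s; case: t.
(* With s = false, the first equation determines t. *)
exists false, (negative u v (+) ~~ negative U V).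
by apply/eqP; rewrite E; move: h; do 4![case: negative].
Qed.

End ZeroDivisors.

(** For independent u and v, the doubling rules from 2 ^ (N - 1) reverse three of
    the four signs.  The cells with u = v or u xor v = T have four signs of
    product -1. *)
Lemma filledP (R : realType) N T u v : 1 < N -> 0 < T < 2 ^ (N - 1) ->
  is_label N T u -> is_label N T v ->
  filled R N T u v <-> indep T u v && quad N T u v.
Proof.
move=> N_gt1 /andP[T_gt0 T_lt]; rewrite /is_label /gen.
case/and3P=> u_gt0 u_le uT /and3P[v_gt0 v_le vT].
have G_gt0 : 0 < 2 ^ (N - 1) by rewrite expn_gt0.
have k_lt : N - 1 < N by lia.
have hu : u < 2 ^ (N - 1) by lia.
have hv : v < 2 ^ (N - 1) by lia.
rewrite filled_parity //; last by lia.
rewrite /strut_partner /gen ![2 ^ _ + xorn _ _]addnC.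
have huT := xorn_lt hu T_lt; have hvT := xorn_lt hv T_lt.
have uT0 : 0 < xorn u T by rewrite lt0n xorn_eq0.
have vT0 : 0 < xorn v T by rewrite lt0n xorn_eq0.
have ind : indep T u v = (u != v) && (xorn u v != T).
  rewrite /indep /in_span !negb_or uT vT xorn_eq0 -!lt0n u_gt0 v_gt0 //.
have neg a b : 0 < a -> 0 < b -> negative N a b = (a == b) || ~~ sgn N a b.
  by rewrite /negative !lt0n => -> ->.
rewrite !neg ?addn_gt0 ?uT0 ?vT0 //.
rewrite ind !eqn_add2r [u == _ + _]ltn_eqF ?[_ + _ == v]gtn_eqF; try lia.
have [<-|uv] := eqVneq u v.
  rewrite eqxx /= (sgn_anti N_gt1 (pow2_lt k_lt hu) (add_pow2_lt k_lt huT)) //;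
    lia.
have xx : (xorn u T == xorn v T) = false by rewrite xorn_eq xornK (negbTE uv).
rewrite xx /=.
have [uvT|uvT] := eqVneq (xorn u v) T.
  have -> : xorn u T = v by rewrite -uvT xorKn.
  have -> : xorn v T = u by rewrite -uvT xornC xornK.
  rewrite sgn_self // sgn_selfl // sgn_top2 1?eq_sym //.
  by rewrite sgn_anti ?(pow2_lt k_lt) //; case: sgn.
have uvT' : u != xorn v T by rewrite -xorn_eq xornC xorn_eq xornC eq_sym.
have u'v : xorn u T != v by rewrite xorn_eq.
rewrite sgn_top2 ?xx // sgn_topr // sgn_topl // /quad.
by case: sgn; case: sgn; case: sgn; case: sgn.
Qed.

(** * Filled cells for two successive additions of a higher bit *)

Theorem theorem16 (R : realType) (N L M S u v : nat)
  (hN : 5 <= N)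
  (hL : exists l : nat, L = 2 ^ l)
  (hM : exists m : nat, M = 2 ^ m)
  (hLM : L < M) (hMG : M < 2 ^ (N - 1))
  (hS1 : 1 <= S) (hSL : S < L)
  (hu1 : is_label N S u) (hu2 : is_label N (S + L) u)
  (hu3 : is_label N (S + L + M) u)
  (hv1 : is_label N S v) (hv2 : is_label N (S + L) v)
  (hv3 : is_label N (S + L + M) v) :
  filled R N S u v ->
  ~ filled R N (S + L) u v ->
  filled R N (S + L + M) u v.
Proof.
have N_gt1 : 1 < N by lia.
case: hL hM => l Ll [m Mm]; rewrite {}Ll {}Mm in hLM hMG hSL hu2 hu3 hv2 hv3 *.
have lm : l < m by rewrite -(ltn_exp2l _ _ (ltnSn 1)).
have mN : m < N - 1 by rewrite -(ltn_exp2l _ _ (ltnSn 1)).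
have dbl i j : i < j -> 2 ^ i + 2 ^ i <= 2 ^ j.
  by move=> ij; rewrite addnn -mul2n -expnS leq_exp2l.
have := (dbl _ _ lm, dbl _ _ mN, dbl (N - 1) N) => -[[h1 h2] h3].
have hu : u < 2 ^ N by move: hu1; rewrite /is_label /gen; lia.
have hv : v < 2 ^ N by move: hv1; rewrite /is_label /gen; lia.
rewrite !filledP //; try lia.
move=> /andP[indS _] /negP; rewrite negb_and => nfilled.
have SLm : S + 2 ^ l < 2 ^ m by lia.
have lN : l < N by lia.
have mN' : m < N by lia.
have mod_mod x : x %% 2 ^ m %% 2 ^ l = x %% 2 ^ l.
  by rewrite modn_dvdm // dvdn_exp2l // ltnW.
have mod_lt x : x %% 2 ^ m < 2 ^ N by apply: (pow2_lt mN'); rewrite ltn_mod expn_gt0.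
(* In the first case [quad_mod_flip] is used at 2 ^ l for the strut constant
   S + L, on u and v and on their remainders modulo 2 ^ m, and at 2 ^ m for
   S + L + M. *)
case: (boolP (indep (S + 2 ^ l) u v)) nfilled => [ind|dep _] /=.
  rewrite quad_mod_flip // negb_imply negbK => /andP[indl quadl].
  have indm : indep (S + 2 ^ l) (u %% 2 ^ m) (v %% 2 ^ m).
    by apply: (@indep_mod _ _ _ l); rewrite !mod_mod modnDr modn_small.
  have ind3 : indep (S + 2 ^ l + 2 ^ m) u v.
    by apply: (@indep_mod _ _ _ m); rewrite modnDr modn_small.
  rewrite ind3 quad_mod_flip ?addn_gt0 ?hS1 // indm quad_mod_flip //.
  by rewrite !mod_mod indl quadl.
have uv : xorn u v = S + 2 ^ l.
  move: dep hu2 hv2 indS; rewrite /indep /in_span /is_label.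
  by do 4!case: eqP => //=; lia.
have ind3 : indep (S + 2 ^ l + 2 ^ m) u v.
  move: hu3 hv3; rewrite /indep /in_span /is_label uv; lia.
rewrite ind3 quad_mod_flip ?addn_gt0 ?hS1 //.
suff /negbTE -> : ~~ indep (S + 2 ^ l) (u %% 2 ^ m) (v %% 2 ^ m) by [].
by rewrite /indep -xorn_mod uv (modn_small SLm) /in_span eqxx orbT !andbF.
Qed.
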